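(* Let $\lambda=(\lambda_1,\dots,\lambda_m)$ be a partition of $n$. Then $I(V_{\mathbb{R}}(\lambda))^{O(n)}$ and $I(V_{\mathbb{R}}(D_\lambda))^{S_n}$ are isomorphic as graded vector spaces.
   Context: A partition $\lambda=(\lambda_1,\dots,\lambda_m)$ of $n$ is a weakly decreasing sequence of positive integers with sum $n$. Let $\mathrm{Sym}_n\cong\mathbb{R}^{n(n+1)/2}$ be the space of real symmetric $n\times n$ matrices and $\mathrm{Diag}_n\cong\mathbb{R}^n$ the subspace of diagonal matrices. $V_{\mathbb{R}}(\lambda)\subset\mathrm{Sym}_n$ is the Zariski closure of the set of real symmetric $n\times n$ matrices having exactly $m$ distinct eigenvalues, with multiplicities $\lambda_1,\dots,\lambda_m$. $V_{\mathbb{R}}(D_\lambda)=V_{\mathbb{R}}(\lambda)\cap\mathrm{Diag}_n$, identified with a variety in $\mathbb{R}^n$. $I(V_{\mathbb{R}}(\lambda))\subset\mathbb{R}[\mathrm{Sym}_n]$ and $I(V_{\mathbb{R}}(D_\lambda))\subset\mathbb{R}[\mathrm{Diag}_n]$ are the ideals of all real polynomial functions on $\mathrm{Sym}_n$, respectively $\mathrm{Diag}_n$, vanishing on the respective variety. The real orthogonal group $O(n)$ acts on $\mathrm{Sym}_n$ by conjugation, and the symmetric group $S_n\subset O(n)$ (permutation matrices) acts on $\mathrm{Diag}_n$ by permuting the diagonal entries. $I(V_{\mathbb{R}}(\lambda))^{O(n)}$ is the vector space of $O(n)$-invariant polynomials in $I(V_{\mathbb{R}}(\lambda))$, and $I(V_{\mathbb{R}}(D_\lambda))^{S_n}$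 is the vector space of $S_n$-invariant polynomials in $I(V_{\mathbb{R}}(D_\lambda))$; both are graded by polynomial degree. *)

(* Defs.v *)
From mathcomp Require Import all_boot all_order all_algebra.
From mathcomp Require Import classical_sets functions reals.
From mathcomp Require Import mpoly.
Set Implicit Arguments.
Unset Strict Implicit.
Unset Printing Implicit Defensive.
Import GRing.Theory.
Local Open Scope classical_set_scope.
Local Open Scope ring_scope.

Definition is_partition (n : nat) (la : seq nat) : Prop :=
  [/\ sorted geq la, all (fun k => 0 < k)%N la & sumn la = n].

Section AffineSpaces.
Variables (R : realType) (n : nat).

Definition symmx : Type := {A : 'M[R]_n | A^T == A}.

(* The coordinates of a symmetric matrix are its entries on and above the
   diagonal, so the coordinate ring of [symmx] is a polynomial ring in
   [#|sym_index|] = n(n+1)/2 variables. *)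
Definition sym_index : finType := {ij : 'I_n * 'I_n | (ij.1 <= ij.2)%N}.

Definition sym_poly := {mpoly R[#|sym_index|]}.

Definition sym_eval (p : sym_poly) (A : symmx) : R :=
  p.@[fun k => let ij := val (enum_val k) in val A ij.1 ij.2].

Definition diag_poly := {mpoly R[n]}.

Definition diag_eval (p : diag_poly) (d : 'rV[R]_n) : R :=
  p.@[fun i => d 0 i].

Lemma diag_symP (d : 'rV[R]_n) : (diag_mx d)^T == diag_mx d.
Proof. by rewrite tr_diag_mx. Qed.

Definition diag_sym (d : 'rV[R]_n) : symmx := exist _ (diag_mx d) (diag_symP d).

Lemma sym_conjP (g : 'M[R]_n) (A : symmx) :
  (g *m val A *m g^T)^T == g *m val A *m g^T.
Proof. by rewrite !trmx_mul trmxK mulmxA (eqP (valP A)). Qed.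

Definition sym_conj (g : 'M[R]_n) (A : symmx) : symmx :=
  exist _ (g *m val A *m g^T) (sym_conjP g A).

Definition orthogonal_mx (g : 'M[R]_n) : Prop := g *m g^T = 1%:M.

End AffineSpaces.

(* [ev p x] is the value at the point [x] of the polynomial function [p]. *)
Section Zariski.
Variables (R : realType) (X P : Type) (ev : P -> X -> R).

Definition zero_locus (U : set P) : set X :=
  [set x | forall p, U p -> ev p x = 0].

Definition zariski_closure (S : set X) : set X :=
  [set x | forall U : set P, S `<=` zero_locus U -> zero_locus U x].

Definition vanishing_ideal (S : set X) : set P :=
  [set p | forall x, S x -> ev p x = 0].

End Zariski.

Section Varieties.
Variables (R : realType) (n : nat) (la : seq nat).

Definition has_eigenvalue_multiplicities (A : symmx R n) : Prop :=
  exists mu : 'I_(size la) -> R,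
    [/\ injective mu,
        forall x, eigenvalue (val A) x <-> exists i, x = mu i
      & forall i, mup (mu i) (char_poly (val A)) = nth 0%N la i].

Definition V_sym : set (symmx R n) :=
  zariski_closure (@sym_eval R n) [set A | has_eigenvalue_multiplicities A].

Definition V_diag : set 'rV[R]_n := [set d | V_sym (diag_sym d)].

Definition invariant_ideal_sym : set (sym_poly R n) :=
  [set p | vanishing_ideal (@sym_eval R n) V_sym p /\
           forall g A, orthogonal_mx g ->
             sym_eval p (sym_conj g A) = sym_eval p A].

Definition invariant_ideal_diag : set (diag_poly R n) :=
  [set p | vanishing_ideal (@diag_eval R n) V_diag p /\ p \is symmetric].

End Varieties.

Section GradedSpaces.
Variable R : realType.

(* A linear subspace that is the direct sum of its homogeneous parts. *)
Definition graded_subspace (k : nat) (V : set {mpoly R[k]}) : Prop :=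
  [/\ V 0,
      forall (a : R) p q, V p -> V q -> V (a *: p + q)
    & forall d p, V p -> V (pihomog mdeg d p)].

(* The values of [phi] outside [V] are irrelevant. *)
Definition graded_isomorphic (k l : nat)
    (V : set {mpoly R[k]}) (W : set {mpoly R[l]}) : Prop :=
  [/\ graded_subspace V, graded_subspace W &
      exists phi : {mpoly R[k]} -> {mpoly R[l]},
        [/\ set_bij V W phi,
            forall (a : R) p q, V p -> V q ->
              phi (a *: p + q) = a *: phi p + phi q
          & forall d p, V p -> (phi p \is d.-homog) = (p \is d.-homog)]].

End GradedSpaces.

(* Main.v *)
Require Import Defs.
From mathcomp Require Import all_boot all_order all_algebra fingroup.perm.
From mathcomp Require Import classical_sets reals.
From mathcomp Require Import mpoly complex ring.

(** The isomorphism is restriction of polynomial functions from symmetric to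
    diagonal matrices ([diag_restriction]): substitute [0] for the off-diagonal
    variables.  It is linear and preserves degrees, so everything rests on
    bijectivity between the two invariant ideals.

    Well defined.  Permutation matrices are orthogonal and permute the entries
    of a diagonal matrix, so the restriction of an invariant polynomial is
    symmetric ([diag_restriction_symmetric]).

    Injective.  By the spectral theorem ([symmetric_spectral]) each orthogonal
    orbit of symmetric matrices meets the diagonal matrices, so an invariant
    function is determined by its values there; and over an infinite field a
    polynomial is determined by its values ([mpoly_vanish0]).

    Surjective.  A symmetric polynomial is [t] evaluated at the elementary
    symmetric polynomials.  Up to sign these are the coefficients of the
    characteristic polynomial of a diagonal matrix, so [t] evaluated at the
    signed coefficients of the characteristic polynomial of a symmetric matrix
    extends it ([spectral_lift]), and the extension is invariant under
    conjugation.  If the symmetric polynomial vanishes on the diagonal part of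
    the variety, then the extension vanishes at every matrix of the stratum,
    because such a matrix is orthogonally conjugate to a diagonal one which lies
    in the stratum too; vanishing then passes to the Zariski closure.

    Both ideals are graded because the stratum is stable under multiplication by
    nonzero scalars: comparing the coefficients of the powers of
    [c] in [p (c A) = 0] makes each homogeneous part vanish at [A]
    ([pihomog_vanish]). *)

Set Implicit Arguments.
Unset Strict Implicit.
Unset Printing Implicit Defensive.

Import Order.TTheory GRing.Theory Num.Theory.
Local Open Scope ring_scope.

(** * Polynomials as functions *)

Section MPolyFunctions.
Variable R : numDomainType.

Lemma poly_vanish0 (q : {poly R}) : (forall t, t != 0 -> q.[t] = 0) -> q = 0.
Proof.
move=> q0; pose s := [seq i.+1%:R : R | i <- iota 0 (size q)].
apply: (@roots_geq_poly_eq0 _ q s).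
- by apply/allP=> _ /mapP[i _ ->]; apply/eqP/q0; rewrite pnatr_eq0.
- rewrite map_inj_uniq ?iota_uniq // => i j /eqP.
  by rewrite eqr_nat eqSS => /eqP.
- by rewrite size_map size_iota.
Qed.

(** [muni] reads a polynomial as a univariate one in its last variable.  No
    coefficient is lost, as a monomial is given by its last exponent and the
    rest. *)
Lemma muni_eq0 n (p : {mpoly R[n.+1]}) : muni p = 0 -> p = 0.
Proof.
move=> p0; apply/mpolyP=> m; rewrite mcoeff0.
pose m' := [multinom m (widen_ord (leqnSn n) i) | i < n].
have m'P (m2 : 'X_{1..n.+1}) :
    [multinom m2 (widen_ord (leqnSn n) i) | i < n] = m' ->
    m2 ord_max = m ord_max -> m2 = m.
  move=> e em; apply/mnmP=> i; case: (unliftP ord_max i) => [j ->|-> //].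
  have -> : lift ord_max j = widen_ord (leqnSn n) j.
    by apply/val_inj; rewrite /= /bump leqNgt ltn_ord.
  by move: e => /(congr1 (fun m3 : 'X_{1..n} => m3 j)); rewrite !mnmE.
have : ((muni p)`_(m ord_max))@_m' = 0 by rewrite p0 coef0 mcoeff0.
rewrite muniE coef_sum raddf_sum /= => <-.
have F (m2 : 'X_{1..n.+1}) :
    (((p@_m2 *: 'X_[[multinom m2 (widen_ord (leqnSn n) i) | i < n]]) *:
      'X^(m2 ord_max))`_(m ord_max))@_m' = if m2 == m then p@_m else 0.
  rewrite coefZ coefXn mulr_natr mcoeffMn mcoeffZ mcoeffX.
  case: (eqVneq m2 m) => [->|ne]; first by rewrite !eqxx mulr1.
  case: (eqVneq _ m') => [e|_]; last by rewrite mulr0 mul0rn.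
  case: eqP => [e'|_ //]; rewrite ?mulr0n //.
  by rewrite (m'P m2) ?eqxx in ne.
rewrite (eq_bigr _ (fun m2 _ => F m2)) -big_mkcond /=.
case: (boolP (m \in msupp p)) => [mp|/memN_msupp_eq0 ->]; last by rewrite big1.
by rewrite -big_filter filter_pred1_uniq ?msupp_uniq // big_seq1.
Qed.

(** By induction on the number of variables: when the first [n] variables are
    fixed, the polynomial in the last one has infinitely many roots, so the
    coefficients, which are polynomials in [n] variables, vanish everywhere. *)
Lemma mpoly_vanish0 n (p : {mpoly R[n]}) : (forall v, p.@[v] = 0) -> p = 0.
Proof.
elim: n p => [|n IHn] p p0.
  have ev v : p.@[v] = p@_0%MM.
    rewrite mevalE [p in RHS]mpolyE raddf_sum; apply: eq_bigr => m _ /=.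
    rewrite mcoeffZ mcoeffX big_ord0; congr (_ * _).
    by have -> : m = 0%MM; [apply/mnmP => -[] | rewrite eqxx].
  apply/mpolyP=> m; rewrite mcoeff0 -(p0 (fun=> 0)) ev.
  by congr (_@__); apply/mnmP; case.
apply/muni_eq0/polyP=> k; rewrite coef0; apply: IHn => v.
suff: map_poly (meval v) (muni p) = 0.
  by move/polyP/(_ k); rewrite coef_map coef0.
apply: poly_vanish0 => t _.
pose vt i := if unlift ord_max i is Some j then v j else t.
rewrite -[RHS](p0 vt) muniE rmorph_sum horner_sum mevalE /=.
apply: eq_bigr => m _; rewrite map_polyZ map_polyXn hornerZ hornerXn /=.
rewrite mevalZ mevalX.
rewrite big_ord_recr /= {2}/vt unlift_none mulrA; congr (_ * _ * _).
apply: eq_bigr => i _; rewrite mnmE /vt.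
have -> : widen_ord (leqnSn n) i = lift ord_max i.
  by apply/val_inj; rewrite /= /bump leqNgt ltn_ord.
by rewrite liftK.
Qed.

Lemma meval_scale n (p : {mpoly R[n]}) t v :
  p.@[fun i => t * v i] =
  \sum_(d < msize p) t ^+ d * (pihomog mdeg d p).@[v].
Proof.
rewrite {1}(pihomog_partitionE (leqnn (msize p))) raddf_sum /=.
apply: eq_bigr => d _; set q := pihomog _ _ _.
have hq : q \is d.-homog by apply: pihomogP.
rewrite !mevalE mulr_sumr !big_seq; apply: eq_bigr => m mq.
have dE : d = mdeg m :> nat by rewrite -(dhomogP _ _ _ hq m mq).
rewrite mulrCA; congr (_ * _); rewrite dE mdegE.
rewrite -prodrXr -big_split /=; apply: eq_bigr => i _.
by rewrite exprMn.
Qed.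

(** The homogeneous parts of [p], evaluated at [v], are the coefficients of
    the univariate polynomial [t |-> p (t v)], which is determined by its values
    at nonzero [t].  The two sides may live in different polynomial rings so that
    a polynomial can be compared with its restriction to a subspace. *)
Lemma pihomog_meval_eq n k (p : {mpoly R[n]}) (q : {mpoly R[k]}) v w d :
  (forall t, t != 0 -> p.@[fun i => t * v i] = q.@[fun i => t * w i]) ->
  (pihomog mdeg d p).@[v] = (pihomog mdeg d q).@[w].
Proof.
(* the polynomial t |-> r (t x) *)
pose P l (r : {mpoly R[l]}) x := \poly_(e < msize r) (pihomog mdeg e r).@[x].
have PE l (r : {mpoly R[l]}) x t : (P l r x).[t] = r.@[fun i => t * x i].
  by rewrite meval_scale horner_poly; apply: eq_bigr => e _; rewrite mulrC.
have Pd l (r : {mpoly R[l]}) x : (P l r x)`_d = (pihomog mdeg d r).@[x].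
  rewrite coef_poly; case: ltnP => // le_d.
  rewrite pihomogE big_seq_cond big_pred0 ?raddf0 // => m.
  apply/negP => /andP[/msize_mdeg_lt lt_m /eqP em].
  by rewrite em ltnNge le_d in lt_m.
move=> pq; suff /eqP : P n p v - P k q w = 0.
  by rewrite subr_eq0 -!Pd => /eqP ->.
by apply: poly_vanish0 => t /pq e; rewrite hornerD hornerN !PE e subrr.
Qed.

Lemma pihomog_vanish n (p : {mpoly R[n]}) v d :
  (forall t, t != 0 -> p.@[fun i => t * v i] = 0) ->
  (pihomog mdeg d p).@[v] = 0.
Proof.
move=> p0; rewrite (@pihomog_meval_eq _ n p 0 v v) ?pihomog0 ?meval0 // => t t0.
by rewrite p0 // meval0.
Qed.

End MPolyFunctions.

(** * The spectral theorem over a real closed field *)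

Section RealSpectral.
Variable R : rcfType.

Lemma mul_row_tr_eq0 n (u : 'rV[R]_n) : ((u *m u^T) 0 0 == 0) = (u == 0).
Proof.
rewrite mxE; apply/eqP/eqP => [|->]; last first.
  by rewrite big1 // => j _; rewrite mxE mul0r.
under eq_bigr do rewrite mxE -expr2.
move/psumr_eq0P => u0; apply/rowP => j; rewrite mxE; apply/eqP.
by rewrite -sqrf_eq0; apply/eqP/u0 => // i _; rewrite sqr_ge0.
Qed.

Lemma mul_row_tr_ge0 n (u : 'rV[R]_n) : 0 <= (u *m u^T) 0 0.
Proof. by rewrite mxE sumr_ge0 // => j _; rewrite mxE -expr2 sqr_ge0. Qed.

(** Take a complex eigenvector [u + i w] with eigenvalue [x + i y].  Comparing
    [(u A) w^T] with [(w A) u^T], which agree by symmetry of [A], gives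
    [y (|u|^2 + |w|^2) = 0].  Hence the eigenvalue is real, and the nonzero
    one among [u] and [w] is a real eigenvector. *)
Lemma symmetric_real_eigenvector n (A : 'M[R]_n) : (0 < n)%N -> A^T = A ->
  exists a (v : 'rV_n), v != 0 /\ v *m A = a *: v.
Proof.
move=> n_gt0 Asym.
pose C := R[i]%type.
pose ReM (z : 'rV[C]_n) : 'rV[R]_n := \row_j complex.Re (z 0 j).
pose ImM (z : 'rV[C]_n) : 'rV[R]_n := \row_j complex.Im (z 0 j).
have [[x y] /eigenvalueP[z zA nz]] :=
  eigenvalue_closed (map_mx (real_complex R) A) n_gt0.
have ReA : ReM z *m A = x *: ReM z - y *: ImM z.
  apply/rowP=> j; move/rowP/(_ j)/(congr1 (@complex.Re _)): zA.
  rewrite !mxE raddf_sum /=; case: (z 0 j) => a b /= <-.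
  apply: eq_bigr => k _; rewrite !mxE; case: (z 0 k) => c d /=; ring.
have ImA : ImM z *m A = x *: ImM z + y *: ReM z.
  apply/rowP=> j; move/rowP/(_ j)/(congr1 (@complex.Im _)): zA.
  rewrite !mxE raddf_sum /=; case: (z 0 j) => a b /= <-.
  apply: eq_bigr => k _; rewrite !mxE; case: (z 0 k) => c d /=; ring.
have nz2 : (ReM z != 0) || (ImM z != 0).
  apply: contraR nz; rewrite negb_or !negbK => /andP[/eqP r0 /eqP i0].
  apply/eqP/rowP=> j; move/rowP/(_ j): r0; move/rowP/(_ j): i0.
  by rewrite !mxE; case: (z 0 j) => a b /= -> ->.
have y0 : y = 0.
  have e : (ReM z *m A) *m (ImM z)^T = ((ImM z *m A) *m (ReM z)^T)^T.
    by rewrite !trmx_mul !trmxK Asym mulmxA.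
  move: e; rewrite ReA ImA mulmxBl mulmxDl -!scalemxAl linearD /= !linearZ /=.
  rewrite !trmx_mul !trmxK => /matrixP/(_ 0 0); rewrite !mxE.
  have := mul_row_tr_ge0 (ReM z); have := mul_row_tr_ge0 (ImM z).
  have := mul_row_tr_eq0 (ReM z); have := mul_row_tr_eq0 (ImM z).
  rewrite !mxE.
  set s := \sum_j _; set t := \sum_j _ => s0 t0 sge tge e.
  have /eqP : y * (s + t) = 0 by rewrite mulrDr -(addrI _ e) mulrN subrr.
  rewrite mulf_eq0 paddr_eq0 // s0 t0 => /orP[/eqP //|/andP[/eqP i0 /eqP r0]].
  by rewrite r0 i0 eqxx in nz2.
case/orP: nz2 => nz2; exists x; [exists (ReM z)|exists (ImM z)]; split=> //.
  by rewrite ReA y0 scale0r subr0.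
by rewrite ImA y0 scale0r addr0.
Qed.

(** The Householder reflection in the hyperplane orthogonal to [w], acting on
    row vectors; for [w = 0] it is the identity. *)
Definition reflection n (w : 'rV[R]_n) : 'M[R]_n :=
  1%:M - (2 / (w *m w^T) 0 0) *: (w^T *m w).

Lemma mul_row_rank1 n (v w u : 'rV[R]_n) :
  v *m (w^T *m u) = (v *m w^T) 0 0 *: u.
Proof.
by rewrite mulmxA [v *m w^T]mx11_scalar mul_scalar_mx !mxE eqxx mulr1n.
Qed.

Lemma reflection_sym n (w : 'rV[R]_n) : (reflection w)^T = reflection w.
Proof. by rewrite /reflection linearB /= linearZ /= trmx_mul trmxK trmx1. Qed.

Lemma reflectionK n (w : 'rV[R]_n) : reflection w *m reflection w = 1%:M.
Proof.
have [->|nz] := eqVneq w 0.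
  by rewrite /reflection mulmx0 scaler0 subr0 mulmx1.
rewrite {1}/reflection mulmxBl mul1mx -scalemxAl -mulmxA.
have -> : w *m reflection w = - w.
  rewrite /reflection mulmxBr mulmx1 -scalemxAr mul_row_rank1 scalerA.
  rewrite divfK ?mul_row_tr_eq0 // scaler_nat mulr2n.
  by rewrite opprD addrA subrr add0r.
by rewrite mulmxN scalerN opprK /reflection subrK.
Qed.

(** Two vectors of the same length are exchanged by the reflection along their
    difference.  This extends an eigenvector to an orthogonal basis without the
    Gram-Schmidt process. *)
Lemma reflection_swap n (v e : 'rV[R]_n) : v *m v^T = e *m e^T ->
  v *m reflection (v - e) = e.
Proof.
move=> ve; have [->|nz] := eqVneq v e.
  by rewrite subrr /reflection mulmx0 scaler0 subr0 mulmx1.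
rewrite /reflection mulmxBr mulmx1 -scalemxAr mul_row_rank1 scalerA.
set w := v - e.
have ww0 : (w *m w^T) 0 0 != 0 by rewrite mul_row_tr_eq0 subr_eq0.
suff -> : 2 / (w *m w^T) 0 0 * (v *m w^T) 0 0 = 1.
  by rewrite scale1r opprB addrC subrK.
have ww : (w *m w^T) 0 0 = 2 * (v *m w^T) 0 0.
  have E : w *m w^T = v *m w^T + v *m w^T.
    have tr11 (B : 'M[R]_1) : B^T = B by apply/matrixP=> i j; rewrite !ord1 mxE.
    rewrite /w linearB /= mulmxBl !mulmxBr -ve -[e *m v^T]tr11 trmx_mul trmxK.
    by rewrite opprB.
  by rewrite E mxE mulr_natl mulr2n.
by rewrite mulrAC -ww divff.
Qed.

(** A reflection moves a real eigenvector onto the first axis.  In the new basis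
    [A] stabilizes that axis, and being symmetric it is block diagonal, so the
    induction hypothesis applies to the complementary block. *)
Theorem symmetric_spectral n (A : 'M[R]_n) : A^T = A ->
  exists (g : 'M_n) (d : 'rV_n), g *m g^T = 1%:M /\ A = g *m diag_mx d *m g^T.
Proof.
elim: n A => [|n IHn] A Asym.
  by exists 1%:M, 0; split; apply/matrixP; case.
have [a [v [nz vA]]] := symmetric_real_eigenvector (ltn0Sn n) Asym.
(* Scaling the axis by the length of v avoids normalizing v. *)
pose c := Num.sqrt ((v *m v^T) 0 0).
pose e0 : 'rV[R]_(1 + n) := row_mx 1%:M 0.
have c0 : c != 0.
  by rewrite sqrtr_eq0 -ltNge lt_def mul_row_tr_eq0 nz mul_row_tr_ge0.
have vv : v *m v^T = (c *: e0) *m (c *: e0)^T.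
  rewrite linearZ /= -scalemxAl -scalemxAr scalerA.
  rewrite -expr2 sqr_sqrtr ?mul_row_tr_ge0 //.
  rewrite tr_row_mx mul_row_col trmx1 mulmx1 trmx0 mulmx0 addr0.
  by rewrite [LHS]mx11_scalar scalemx1.
pose g := reflection (v - c *: e0).
have gT : g^T = g by apply: reflection_sym.
have gK : g *m g = 1%:M by apply: reflectionK.
have vg : v *m g = c *: e0 by apply: reflection_swap.
pose B : 'M_(1 + n) := g *m A *m g.
have Bsym : B^T = B by rewrite /B !trmx_mul gT Asym mulmxA.
have e0B : e0 *m B = a *: e0.
  have -> : e0 = c^-1 *: (v *m g) by rewrite vg scalerA mulVf // scale1r.
  rewrite /B -!scalemxAl !mulmxA -[v *m g *m g]mulmxA gK mulmx1 vA.
  by rewrite -scalemxAl !scalerA mulrC.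
have BE : B = block_mx a%:M 0 0 (drsubmx B).
  have uB : usubmx B = row_mx a%:M 0.
    move: e0B; rewrite -[in e0 *m _](vsubmxK B) mul_row_col mul1mx.
    rewrite mul0mx addr0 => ->.
    by rewrite scale_row_mx scalemx1 scaler0.
  have dlB : dlsubmx B = 0.
    by rewrite -[B]Bsym -trmx_ursub /ursubmx uB row_mxKr trmx0.
  by rewrite -[LHS]submxK /ulsubmx /ursubmx uB row_mxKl row_mxKr dlB.
have Dsym : (drsubmx B)^T = drsubmx B by rewrite trmx_drsub Bsym.
have [h [d [hh dE]]] := IHn _ Dsym.
pose k : 'M_(1 + n) := block_mx 1%:M 0 0 h.
have kk : k *m k^T = 1%:M.
  rewrite /k tr_block_mx !trmx0 trmx1 mulmx_block !(mulmx0, mul0mx, addr0, add0r).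
  by rewrite mulmx1 hh -scalar_mx_block.
have BkE : B = k *m diag_mx (row_mx a%:M d) *m k^T.
  rewrite BE diag_mx_row /k tr_block_mx !trmx0 trmx1.
  rewrite !mulmx_block !(mulmx0, mul0mx, addr0, add0r, mulmx1, mul1mx) dE.
  by congr (block_mx _ 0 0 _); apply/matrixP=> i j; rewrite !ord1 !mxE.
exists (g *m k), (row_mx a%:M d); split.
  by rewrite trmx_mul mulmxA -[g *m k *m k^T]mulmxA kk mulmx1 gT.
have -> : A = g *m B *m g by rewrite /B !mulmxA gK mul1mx -mulmxA gK mulmx1.
by rewrite BkE trmx_mul gT !mulmxA.
Qed.
End RealSpectral.

(** * Characteristic polynomials *)

Lemma char_poly_orthogonal_conj (R : comNzRingType) n (g A : 'M[R]_n) :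
  g *m g^T = 1%:M -> char_poly (g *m A *m g^T) = char_poly A.
Proof.
move=> gg; rewrite /char_poly.
pose G := map_mx (@polyC R) g.
have GG : G *m G^T = 1%:M by rewrite /G map_trmx -map_mxM gg map_mx1.
have -> : char_poly_mx (g *m A *m g^T) = G *m char_poly_mx A *m G^T.
  rewrite /char_poly_mx !map_mxM -map_trmx mulmxBr mulmxBl -/G.
  by rewrite scalar_mxC -['X%:M *m G *m _]mulmxA GG mulmx1.
by rewrite !det_mulmx mulrAC -det_mulmx GG det1 mul1r.
Qed.

Lemma char_poly_diag (R : comNzRingType) n (d : 'rV[R]_n) :
  char_poly (diag_mx d) = \prod_(i < n) ('X - (d 0 i)%:P).
Proof.
rewrite char_poly_trig ?diag_mx_is_trig //; apply: eq_bigr => i _.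
by rewrite mxE eqxx mulr1n.
Qed.

Lemma mup_prod_XsubC (F : fieldType) (I : finType) (d : I -> F) x :
  mup x (\prod_i ('X - (d i)%:P)) = #|[pred i | d i == x]|.
Proof.
rewrite -sum1_card [RHS]big_mkcond /=.
suff [] : (\prod_i ('X - (d i)%:P) != 0) /\
    mup x (\prod_i ('X - (d i)%:P)) =
    (\sum_i (if d i == x then 1 else 0))%N; first by move=> _ ->.
elim/big_rec2: _ => [|i m q _ [q0 <-]].
  by split; rewrite ?oner_eq0 // mupNroot // root1.
split; first by rewrite mulf_neq0 // polyXsubC_eq0.
by rewrite mupM ?polyXsubC_eq0 // -[X in mup x X]expr1 mup_XsubCX.
Qed.

(** * The strata and their scaling invariance *)

Section Strata.
Variables (R : realType) (n : nat) (la : seq nat).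

(** The stratum condition read off from the diagonal entries, without reference
    to a characteristic polynomial: scaling is evident in this form. *)
Definition spectrum_multiplicities (d : 'rV[R]_n) : Prop :=
  exists mu : 'I_(size la) -> R,
    [/\ injective mu,
        forall x, (exists j, x = d 0 j) <-> (exists i, x = mu i)
      & forall i, #|[pred j | d 0 j == mu i]| = nth 0%N la i].

(** Eigenvalues and their multiplicities depend on the characteristic polynomial
    only. *)
Lemma multiplicitiesP (A : symmx R n) (d : 'rV[R]_n) :
  char_poly (val A) = char_poly (diag_mx d) ->
  has_eigenvalue_multiplicities la A <-> spectrum_multiplicities d.
Proof.
move=> cA.
have eigE x : eigenvalue (val A) x <-> exists j, x = d 0 j.
  rewrite eigenvalue_root_char cA char_poly_diag.
  rewrite -(big_map (d 0) xpredT (fun c => 'X - c%:P)) root_prod_XsubC.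
  split=> [/mapP[j _ ->]|[j ->]]; first by exists j.
  by apply: map_f; rewrite mem_index_enum.
have mupE x : mup x (char_poly (val A)) = #|[pred j | d 0 j == x]|.
  by rewrite cA char_poly_diag mup_prod_XsubC.
by split=> -[mu [mu_inj mu_eig mu_la]]; exists mu; split=> // [x|i];
  rewrite -?mu_eig -?mu_la ?mupE // eigE.
Qed.

Lemma spectrum_multiplicitiesZ t d : t != 0 ->
  spectrum_multiplicities d -> spectrum_multiplicities (t *: d).
Proof.
move=> t0 [mu [mu_inj mu_eig mu_la]]; exists (fun i => t * mu i); split.
- by move=> i j /(mulfI t0) /mu_inj.
- move=> x; split=> [[j ->]|[i ->]].
    have [|i e] := (mu_eig (d 0 j)).1; first by exists j.
    by exists i; rewrite mxE e.
  have [|j e] := (mu_eig (mu i)).2; first by exists i.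
  by exists j; rewrite mxE e.
- move=> i; rewrite -mu_la; apply: eq_card => j.
  by rewrite !inE mxE (inj_eq (mulfI t0)).
Qed.

Lemma orthogonal_diagonalization (A : symmx R n) :
  exists g d, orthogonal_mx g /\ A = sym_conj g (diag_sym d).
Proof.
have [g [d [gg Ad]]] := symmetric_spectral (eqP (valP A)).
by exists g, d; split=> //; apply/val_inj.
Qed.

Lemma sym_conj_multiplicities g d : orthogonal_mx g ->
  has_eigenvalue_multiplicities la (sym_conj g (diag_sym d)) <->
  spectrum_multiplicities d.
Proof.
by move=> gg; apply: multiplicitiesP; apply: char_poly_orthogonal_conj.
Qed.

Lemma diag_multiplicities d :
  has_eigenvalue_multiplicities la (diag_sym d) <-> spectrum_multiplicities d.
Proof. exact: multiplicitiesP. Qed.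

Lemma V_sym_stratum (A : symmx R n) :
  has_eigenvalue_multiplicities la A -> V_sym la A.
Proof. by move=> hA U; apply. Qed.

(** A polynomial that vanishes on a set belongs to the equations which define
    its Zariski closure. *)
Lemma vanish_V_symP (p : sym_poly R n) :
  vanishing_ideal (@sym_eval R n) (V_sym la) p <->
  (forall A : symmx R n,
    has_eigenvalue_multiplicities la A -> sym_eval p A = 0).
Proof.
split=> [p0 A hA|p0 A]; first exact/p0/V_sym_stratum.
by move/(_ [set p]%classic); apply=> // B hB _ ->; apply: p0.
Qed.

Lemma sym_scaleP (t : R) (A : symmx R n) : (t *: val A)^T == t *: val A.
Proof. by rewrite linearZ /= (eqP (valP A)). Qed.

Definition sym_scale (t : R) (A : symmx R n) : symmx R n :=
  exist _ (t *: val A) (sym_scaleP t A).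

Lemma sym_scale_conj t g (d : 'rV[R]_n) :
  sym_scale t (sym_conj g (diag_sym d)) = sym_conj g (diag_sym (t *: d)).
Proof.
by apply/val_inj; rewrite /= linearZ /= -scalemxAr -scalemxAl.
Qed.

Lemma multiplicities_scale t (A : symmx R n) : t != 0 ->
  has_eigenvalue_multiplicities la A ->
  has_eigenvalue_multiplicities la (sym_scale t A).
Proof.
move=> t0; have [g [d [gg ->]]] := orthogonal_diagonalization A.
rewrite sym_scale_conj !sym_conj_multiplicities //.
exact: spectrum_multiplicitiesZ.
Qed.

Lemma sym_eval_scale (p : sym_poly R n) t A : sym_eval p (sym_scale t A) =
  p.@[fun k => t * (let ij := val (enum_val k) in val A ij.1 ij.2)].
Proof. by apply: meval_eq => k; rewrite /= mxE. Qed.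

Lemma vanish_V_sym_homog d (p : sym_poly R n) :
  vanishing_ideal (@sym_eval R n) (V_sym la) p ->
  vanishing_ideal (@sym_eval R n) (V_sym la) (pihomog mdeg d p).
Proof.
move=> /vanish_V_symP p0; apply/vanish_V_symP => A hA.
apply: pihomog_vanish => t t0.
by rewrite -sym_eval_scale p0 //; apply: multiplicities_scale.
Qed.

(** The equations of the closure have vanishing homogeneous parts on the closure,
    and [p (t A)] is a combination of the values of these parts at [A]. *)
Lemma V_sym_scale t (A : symmx R n) : V_sym la A -> V_sym la (sym_scale t A).
Proof.
move=> hA U hU p Up.
have p0 : vanishing_ideal (@sym_eval R n) (V_sym la) p.
  by apply/vanish_V_symP => B hB; apply: hU.
rewrite sym_eval_scale meval_scale big1 // => d _.
by rewrite [X in _ * X](vanish_V_sym_homog d p0) // mulr0.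
Qed.

Lemma vanish_V_diag_homog d (q : diag_poly R n) :
  vanishing_ideal (@diag_eval R n) (V_diag la) q ->
  vanishing_ideal (@diag_eval R n) (V_diag la) (pihomog mdeg d q).
Proof.
move=> q0 v hv; apply: pihomog_vanish => t t0.
have <- : diag_eval q (t *: v) = q.@[fun i => t * v 0 i].
  by apply: meval_eq => i; rewrite mxE.
apply: q0; rewrite /V_diag /mkset.
have -> : diag_sym (t *: v) = sym_scale t (diag_sym v).
  by apply/val_inj; rewrite /= linearZ.
exact: V_sym_scale.
Qed.

Lemma invariant_homog d (p : sym_poly R n) :
  (forall g A, orthogonal_mx g -> sym_eval p (sym_conj g A) = sym_eval p A) ->
  forall g A, orthogonal_mx g -> sym_eval (pihomog mdeg d p) (sym_conj g A) =
    sym_eval (pihomog mdeg d p) A.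
Proof.
move=> pI g A hg; apply: pihomog_meval_eq => t t0.
rewrite -!sym_eval_scale -[RHS](pI g) //; congr (sym_eval p _).
by apply/val_inj; rewrite /= -scalemxAr -scalemxAl.
Qed.

Lemma invariant_ideal_sym_graded :
  graded_subspace (@invariant_ideal_sym R n la).
Proof.
split.
- by split=> [A _|g A _]; rewrite /sym_eval !meval0.
- move=> a p q [p0 pI] [q0 qI]; split=> [A hA|g A hg];
    rewrite /sym_eval !mevalD !mevalZ.
    by rewrite [X in a * X]p0 // [X in _ + X]q0 // mulr0 addr0.
  by congr (_ * _ + _); [apply: pI|apply: qI].
- move=> d p [p0 pI]; split; first exact: vanish_V_sym_homog.
  exact: invariant_homog.
Qed.

Lemma invariant_ideal_diag_graded :
  graded_subspace (@invariant_ideal_diag R n la).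
Proof.
split.
- by split=> [v _|]; rewrite /diag_eval ?meval0 // rpred0.
- move=> a p q [p0 pI] [q0 qI]; split=> [v hv|].
    rewrite /diag_eval mevalD mevalZ [X in a * X]p0 // [X in _ + X]q0 //.
    by rewrite mulr0 addr0.
  by rewrite rpredD // rpredZ.
- move=> d p [p0 pI]; split; first exact: vanish_V_diag_homog.
  exact: pihomog_sym.
Qed.
End Strata.

(** * Restriction to diagonal matrices and its inverse *)

Section Restriction.
Variables (R : realType) (n : nat).

Definition diag_restriction (p : sym_poly R n) : diag_poly R n :=
  p \mPo [tuple (let ij := val (enum_val k) in
                 if ij.1 == ij.2 then 'X_ij.1 else 0) | k < #|sym_index n|].

Lemma diag_restrictionE p d :
  diag_eval (diag_restriction p) d = sym_eval p (diag_sym d).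
Proof.
rewrite /diag_eval comp_mpoly_meval; apply: meval_eq => k.
rewrite tnth_mktuple /= mxE; case: eqP => _; last by rewrite meval0 mulr0n.
by rewrite mevalXU mulr1n.
Qed.

Lemma diag_poly_ext (p q : diag_poly R n) :
  (forall d, diag_eval p d = diag_eval q d) -> p = q.
Proof.
move=> pq; apply/eqP; rewrite -subr_eq0; apply/eqP/mpoly_vanish0 => v.
have E (r : diag_poly R n) : r.@[v] = diag_eval r (\row_i v i).
  by apply: meval_eq => i; rewrite mxE.
by rewrite mevalB !E pq subrr.
Qed.

Lemma diag_restriction_linear a p q :
  diag_restriction (a *: p + q) = a *: diag_restriction p + diag_restriction q.
Proof. by rewrite /diag_restriction comp_mpolyD comp_mpolyZ. Qed.

Lemma diag_restriction_pihomog e p :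
  diag_restriction (pihomog mdeg e p) = pihomog mdeg e (diag_restriction p).
Proof.
apply: diag_poly_ext => d; rewrite diag_restrictionE.
apply: pihomog_meval_eq => t _; rewrite -sym_eval_scale.
have -> : sym_scale t (diag_sym d) = diag_sym (t *: d).
  by apply/val_inj; rewrite /= linearZ.
by rewrite -diag_restrictionE; apply: meval_eq => i; rewrite mxE.
Qed.

Definition ordered_pair (i j : 'I_n) : 'I_n * 'I_n :=
  if (i <= j)%N then (i, j) else (j, i).

Lemma ordered_pair_le i j : ((ordered_pair i j).1 <= (ordered_pair i j).2)%N.
Proof. by rewrite /ordered_pair; case: (leqP i j) => //= /ltnW. Qed.

Lemma ordered_pairC i j : ordered_pair i j = ordered_pair j i.
Proof.
by rewrite /ordered_pair; case: ltngtP => // /val_inj ->.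
Qed.

Definition entry_index (i j : 'I_n) : 'I_#|sym_index n| :=
  enum_rank (Sub (ordered_pair i j) (ordered_pair_le i j) : sym_index n).

(** The symmetric matrix with prescribed coordinates.  Any type of entries is
    allowed, so that the generic matrix, whose entries are the variables, and its
    values are instances. *)
Definition symmetric_matrix (T : Type) (v : 'I_#|sym_index n| -> T) : 'M[T]_n :=
  \matrix_(i, j) v (entry_index i j).

Lemma trmx_symmetric_matrix (T : Type) (v : 'I_#|sym_index n| -> T) :
  (symmetric_matrix v)^T = symmetric_matrix v.
Proof.
apply/matrixP => i j; rewrite !mxE /entry_index; congr (v (enum_rank _)).
by apply/val_inj; rewrite /= ordered_pairC.
Qed.

Lemma entry_index_val k :
  entry_index (val (enum_val k)).1 (val (enum_val k)).2 = k.
Proof.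
rewrite -[RHS]enum_valK /entry_index; congr enum_rank; apply/val_inj => /=.
by rewrite /ordered_pair; case: (enum_val k) => -[i j] /= ->.
Qed.

Lemma symmetric_matrix_entries (A : symmx R n) :
  symmetric_matrix
    (fun k => let ij := val (enum_val k) in val A ij.1 ij.2) = val A.
Proof.
apply/matrixP => i j; rewrite mxE /entry_index enum_rankK /= /ordered_pair.
by case: leqP => //= _; rewrite -{1}(eqP (valP A)) mxE.
Qed.

Lemma sym_poly_ext (p q : sym_poly R n) :
  (forall A, sym_eval p A = sym_eval q A) -> p = q.
Proof.
move=> pq; apply/eqP; rewrite -subr_eq0; apply/eqP/mpoly_vanish0 => v.
have Msym : (symmetric_matrix v)^T == symmetric_matrix v.
  by rewrite trmx_symmetric_matrix.
have E (r : sym_poly R n) :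
    r.@[v] = sym_eval r (exist _ (symmetric_matrix v) Msym).
  by apply: meval_eq => k; rewrite /= mxE entry_index_val.
by rewrite mevalB !E pq subrr.
Qed.

Definition generic_char_poly : {poly sym_poly R n} :=
  char_poly (symmetric_matrix (fun k => 'X_k)).

Lemma generic_char_polyE k (A : symmx R n) :
  sym_eval (generic_char_poly`_k) A = (char_poly (val A))`_k.
Proof.
rewrite /sym_eval -[LHS]coef_map map_char_poly; congr ((char_poly _)`__).
rewrite -[RHS]symmetric_matrix_entries; apply/matrixP => i j.
by rewrite !mxE /= mevalXU.
Qed.

(** The value of [t] at the elementary symmetric functions of the eigenvalues,
    which are the signed coefficients of the characteristic polynomial. *)
Definition spectral_lift (t : {mpoly R[n]}) : sym_poly R n :=
  t \mPo [tuple (-1) ^+ i.+1 * generic_char_poly`_(n - i.+1) | i < n].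

Lemma spectral_liftE t A : sym_eval (spectral_lift t) A =
  t.@[fun i : 'I_n => (-1) ^+ i.+1 * (char_poly (val A))`_(n - i.+1)].
Proof.
rewrite /sym_eval comp_mpoly_meval; apply: meval_eq => i.
rewrite tnth_mktuple mevalM [X in _ * X]generic_char_polyE.
by rewrite !rmorphXn rmorphN rmorph1.
Qed.

Lemma spectral_lift_diag t d : sym_eval (spectral_lift t) (diag_sym d) =
  diag_eval (t \mPo [tuple mesym n R i.+1 | i < n]) d.
Proof.
rewrite spectral_liftE /diag_eval comp_mpoly_meval; apply: meval_eq => i.
rewrite tnth_mktuple /= char_poly_diag.
(* The coefficient of index [n - k] is, up to sign, the elementary symmetric
   polynomial of degree [k = i + 1]. *)
have := mroots_coeff [tuple d 0 i | i < n] (lift ord0 i).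
rewrite big_tuple; under eq_bigr do rewrite tnth_mktuple.
rewrite /= /bump /= add1n => ->.
rewrite mulrA -exprMn mulN1r opprK expr1n mul1r.
by apply: meval_eq => j; rewrite tnth_mktuple.
Qed.

Lemma spectral_lift_conj t g A : orthogonal_mx g ->
  sym_eval (spectral_lift t) (sym_conj g A) = sym_eval (spectral_lift t) A.
Proof.
by move=> gg; rewrite !spectral_liftE /= char_poly_orthogonal_conj.
Qed.

Lemma diag_restriction_symmetric p :
  (forall g A, orthogonal_mx g -> sym_eval p (sym_conj g A) = sym_eval p A) ->
  diag_restriction p \is symmetric.
Proof.
move=> pI; apply/issymP => s; apply: diag_poly_ext => d.
have -> : diag_eval (msym s (diag_restriction p)) d =
    diag_eval (diag_restriction p) (\row_i d 0 (s i)).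
  rewrite /diag_eval -[msym s _]comp_mpoly_id msym_mPo comp_mpoly_meval.
  by apply: meval_eq => i; rewrite !tnth_mktuple mevalXU mxE.
rewrite !diag_restrictionE.
have hs : orthogonal_mx (perm_mx s : 'M[R]_n).
  by rewrite /orthogonal_mx tr_perm_mx -perm_mxM mulgV perm_mx1.
rewrite -[RHS](pI (perm_mx s)) //; congr (sym_eval p _); apply/val_inj => /=.
rewrite tr_perm_mx -row_permE -col_permE; apply/matrixP => i j.
by rewrite !mxE (inj_eq perm_inj).
Qed.

End Restriction.

Theorem theorem4p4 (R : realType) (n : nat) (la : seq nat)
    (hla : is_partition n la) :
  graded_isomorphic (@invariant_ideal_sym R n la)
                    (@invariant_ideal_diag R n la).
Proof.
have phi_inj p q : invariant_ideal_sym la p -> invariant_ideal_sym la q ->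
    diag_restriction p = diag_restriction q :> diag_poly R n -> p = q.
  move=> [_ pI] [_ qI] pq; apply: sym_poly_ext => A.
  have [g [d [gg ->]]] := orthogonal_diagonalization A.
  by rewrite pI // qI // -!diag_restrictionE pq.
split; [exact: invariant_ideal_sym_graded|exact: invariant_ideal_diag_graded|].
exists (@diag_restriction R n); split.
- split.
  + move=> p [p0 pI]; split; last exact: diag_restriction_symmetric.
    by move=> d hd; rewrite diag_restrictionE; apply: p0.
  + by move=> p q /set_mem hp /set_mem hq; apply: phi_inj.
  + move=> q [q0 qS]; have [t [tq _]] := sym_fundamental qS.
    exists (spectral_lift t); last first.
      apply: diag_poly_ext => d.
      by rewrite diag_restrictionE spectral_lift_diag tq.
    split; last by move=> g A; apply: spectral_lift_conj.
    apply/vanish_V_symP => A hA.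
    have [g [d [gg AE]]] := orthogonal_diagonalization A.
    rewrite AE spectral_lift_conj // spectral_lift_diag tq; apply: q0.
    apply/V_sym_stratum/diag_multiplicities.
    by rewrite -(sym_conj_multiplicities _ _ gg) -AE.
- by move=> a p q _ _; apply: diag_restriction_linear.
- move=> d p hp; rewrite !homog_piE -diag_restriction_pihomog.
  apply/eqP/eqP => [|->] //; apply: phi_inj => //.
  by have [_ _] := invariant_ideal_sym_graded R n la; apply.
Qed.
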